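(* Let $\mathcal H$ be a Hilbert space, let $\mathcal C$ be a family of closed subspaces of $\mathcal H$ containing the zero subspace and having the Minimal Approximation Property, let $m,l$ be positive integers with $l\le m$, and let $\mathcal F=\{f_1,\dots,f_m\}$ be a set of vectors in $\mathcal H$. Then: (1) There exists a bundle $\mathbf V_0\in\mathfrak B$ such that $$e(\mathcal F,\mathbf V_0)=\inf\{e(\mathcal F,\mathbf V):\mathbf V\in\mathfrak B\}.$$ (2) If $(P_0,\mathbf V_{P_0})$ is a $\Gamma$-minimal pair, then every $\mathbf V\in\mathcal W(P_0)$ satisfies $e(\mathcal F,\mathbf V)=\inf\{e(\mathcal F,\mathbf V'):\mathbf V'\in\mathfrak B\}$. (3) If $\mathbf V_0\in\mathfrak B$ satisfies $e(\mathcal F,\mathbf V_0)=\inf\{e(\mathcal F,\mathbf V):\mathbf V\in\mathfrak B\}$, then there exists $P_0\in\Pi_l$ such that $\mathbf V_0\in\mathcal W(P_0)$ and $(P_0,\mathbf V_0)$ is a $\Gamma$-minimal pair.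
   Context: For $x,y\in\mathcal H$, $d(x,y)=\|x-y\|_{\mathcal H}$, and $d(f,V)=\inf_{v\in V}d(f,v)$ for a closed subspace $V$. For a finite set $\mathcal G\subset\mathcal H$ and a closed subspace $V$, $E(\mathcal G,V)=\sum_{f\in\mathcal G}d^2(f,V)$, with $E(\emptyset,V)=0$. $\mathcal C$ has the Minimal Approximation Property (MAP) if for every finite set $\mathcal G\subset\mathcal H$ there is $V_0\in\mathcal C$ with $E(\mathcal G,V_0)\le E(\mathcal G,V)$ for all $V\in\mathcal C$. Any such $V_0$ is called an optimal subspace for $\mathcal G$ (so every $V\in\mathcal C$ is optimal for $\mathcal G=\emptyset$). $\mathfrak B=\mathfrak B(l)$ is the set of all sequences (called bundles) $\mathbf V=\{V_1,\dots,V_l\}$ of length $l$ with $V_i\in\mathcal C$ for all $i$ (repetitions allowed). For $\mathbf V=\{V_1,\dots,V_l\}\in\mathfrak B$, $$e(\mathcal F,\mathbf V)=\sum_{f\in\mathcal F}\min_{1\le j\le l}d^2(f,V_j).$$ $\Pi_l$ is the set of all $l$-sequences $P=\{\mathcal F_1,\dots,\mathcal F_l\}$ of subsets of $\mathcal F$ (possibly empty), pairwise disjoint for distinct indices, with $\mathcal F=\bigcup_{s=1}^l\mathcal F_s$; its elements are called partitions. For $P=\{\mathcal F_1,\dots,\mathcal F_l\}\in\Pi_l$ and $\mathbf V=\{V_1,\dots,V_l\}\in\mathfrak B$, $$\Gamma(P,\mathbf V)=\sum_{i=1}^lE(\mathcal F_i,V_i).$$ For $P=\{\mathcal F_1,\dots,\mathcal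 F_l\}\in\Pi_l$, $\mathcal W(P)\subset\mathfrak B$ is the set of bundles $\{V_1,\dots,V_l\}\in\mathfrak B$ such that $V_i$ is an optimal subspace for $\mathcal F_i$ for each $i=1,\dots,l$. A pair $(P_0,\mathbf V_{P_0})$ with $P_0\in\Pi_l$ and $\mathbf V_{P_0}\in\mathcal W(P_0)$ is called $\Gamma$-minimal if $\Gamma(P_0,\mathbf V_{P_0})\le\Gamma(P,\mathbf V_P)$ for all pairs $(P,\mathbf V_P)$ with $P\in\Pi_l$ and $\mathbf V_P\in\mathcal W(P)$. *)

(* Defs.v *)
From HB Require Import structures.
From mathcomp Require Import all_boot all_order all_algebra finmap complex.
From mathcomp Require Import all_classical all_reals all_analysis.

Set Implicit Arguments.
Unset Strict Implicit.
Unset Printing Implicit Defensive.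
Import Order.TTheory GRing.Theory Num.Theory.
Import numFieldNormedType.Exports.
Local Open Scope classical_set_scope.
Local Open Scope ring_scope.

(* Hilbert spaces may be real or complex: the boolean selects the field.      *)
Definition scalar_field (R : realType) (cplx : bool) : numFieldType :=
  if cplx then R[i] : numFieldType else R : numFieldType.

Definition scalar_re (R : realType) (cplx : bool) : scalar_field R cplx -> R :=
  if cplx return scalar_field R cplx -> R then @complex.Re R else id.

Definition scalar_conj (R : realType) (cplx : bool) :
    scalar_field R cplx -> scalar_field R cplx :=
  if cplx return scalar_field R cplx -> scalar_field R cplx then @conjc R else id.

HB.mixin Record CompleteNormedModule_isHilbert (R : realType) (cplx : bool) H
    of CompleteNormedModule (scalar_field R cplx) H := {
  hdot : {dot H for @scalar_conj R cplx};
  hdotE : forall x : H, hdot x x = `|x| ^+ 2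
}.

#[short(type="hilbertType")]
HB.structure Definition Hilbert (R : realType) (cplx : bool) :=
  {H of CompleteNormedModule (scalar_field R cplx) H
      & CompleteNormedModule_isHilbert R cplx H}.

(* The minimum of a_0, ..., a_(l-1); the default value 0 is only used when    *)
(* l = 0.                                                                     *)
Definition min_ord (R : realType) (l : nat) (a : 'I_l -> R) : R :=
  \big[Num.min/head 0 (codom a)]_(j < l) a j.

Lemma min_ord_le (R : realType) (l : nat) (a : 'I_l -> R) j : min_ord a <= a j.
Proof. exact: bigmin_le_cond. Qed.

Lemma min_ord_attained (R : realType) (l : nat) (a : 'I_l -> R) :
  (0 < l)%N -> exists j, min_ord a = a j.
Proof.
case: l a => // n a _; rewrite /min_ord /codom /image_mem enum_ordSl /=.
by elim/big_ind: _ => [|x y [i ->] [j ->]|i _];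
   [exists ord0|rewrite /Num.min; case: ifP => _; [exists i|exists j]|exists i].
Qed.

Section Approximation.
Variables (R : realType) (cplx : bool) (H : hilbertType R cplx).
Implicit Types (x y f : H) (V : set H) (C : set (set H)) (F G : {fset H}).

Definition closed_subspace V : Prop :=
  [/\ closed V, V 0 &
      forall (a : scalar_field R cplx) x y, V x -> V y -> V (a *: x + y)].

(* The library norm is valued in the scalar field; its values are real.       *)
Definition hdist x y : R := scalar_re `|x - y|.

Definition dist_to f V : R := inf [set hdist f v | v in V].

Definition E G V : R := \sum_(f <- G) dist_to f V ^+ 2.

Definition optimal C G V0 : Prop :=
  C V0 /\ forall V, C V -> E G V0 <= E G V.

Definition MAP C : Prop := forall G, exists V0, optimal C G V0.

Section Bundles.
Variable l : nat.
Implicit Types (P : 'I_l -> {fset H}) (W : 'I_l -> set H).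

Definition bundle C : set ('I_l -> set H) := [set W | forall i, C (W i)].

Definition e F W : R := \sum_(f <- F) min_ord (fun j => dist_to f (W j) ^+ 2).

Definition fpartition F : set ('I_l -> {fset H}) :=
  [set P : 'I_l -> {fset H} | (forall i j, i != j -> [disjoint P i & P j]%fset) /\
           F = \big[fsetU/fset0]_(i < l) P i].

Definition Gamma P W : R := \sum_(i < l) E (P i) (W i).

Definition optimal_bundle C P : set ('I_l -> set H) :=
  [set W | bundle C W /\ forall i, optimal C (P i) (W i)].

Definition Gamma_minimal C F P0 W0 : Prop :=
  [/\ fpartition F P0, optimal_bundle C P0 W0 &
      forall P W, fpartition F P -> optimal_bundle C P W ->
        Gamma P0 W0 <= Gamma P W].

End Bundles.

End Approximation.

(* Main.v *)
Require Import Defs.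
From HB Require Import structures.
From mathcomp Require Import all_boot all_order all_algebra finmap complex.
From mathcomp Require Import all_classical all_reals all_analysis.

Set Implicit Arguments.
Unset Strict Implicit.
Unset Printing Implicit Defensive.
Import Order.TTheory GRing.Theory Num.Theory.
Import numFieldNormedType.Exports.
Local Open Scope classical_set_scope.
Local Open Scope ring_scope.

(* The map (P, V) |-> Gamma P V dominates e F V, with equality for the partition
   that sends each vector of F to a nearest subspace of V.  Since Gamma P is
   minimized by the bundles optimal for P, minimizing e F over bundles amounts to
   minimizing Gamma over the finitely many partitions of F, each paired with an
   optimal bundle. *)

Section BundlesAndPartitions.
Variables (R : realType) (cplx : bool) (H : hilbertType R cplx).
Implicit Types (C : set (set H)) (F : {fset H}).

Lemma big_fpartition (l : nat) F (P : 'I_l -> {fset H}) (g : H -> R) :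
  fpartition F P -> \sum_(x <- F) g x = \sum_(i < l) \sum_(x <- P i) g x.
Proof.
move=> [disjP ->].
(* Passing from the index type to a finite set of indices brings both big operators into the form
   that [partition_disjoint_bigfcup] expects. *)
have allE (S : Type) (idx : S) (op : Monoid.com_law idx) (h : 'I_l -> S) :
    \big[op/idx]_(i < l) h i = \big[op/idx]_(i <- [fset i | i in 'I_l]%fset) h i.
  by rewrite big_imfset //= big_enum.
rewrite (allE _ _ _ P) partition_disjoint_bigfcup -?allE // => i j _ _.
exact: disjP.
Qed.

Lemma fpartition_of_fun (l : nat) F (s : H -> 'I_l) :
  fpartition F (fun i => [fset x in F | s x == i]%fset).
Proof.
split=> [i j neq_ij|].
  apply/fdisjointP => x; rewrite !inE /= => /andP[_ /eqP->].
  by rewrite (negbTE neq_ij) andbF.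
apply/fsetP => x; apply/idP/bigfcupP => [Fx|[i _]].
  by exists (s x); rewrite ?mem_index_enum // !inE Fx eqxx.
by rewrite !inE => /andP[].
Qed.

(** [{fset H}] is not a finite type, but every cell of a partition of [F] lies in [fpowerset F].
    Partitions are therefore coded by finite functions, among which a minimizer of any [phi]
    exists. *)
Lemma fpartition_argmin (l : nat) F (phi : ('I_l -> {fset H}) -> R) :
  (0 < l)%N -> exists2 P0, fpartition F P0 &
    forall P, fpartition F P -> phi P0 <= phi P.
Proof.
move=> l_gt0.
have code (P : 'I_l -> {fset H}) : fpartition F P ->
    exists Q : {ffun 'I_l -> fpowerset F}, P = fun i => val (Q i).
  move=> [_ FE].
  have PF i : P i \in fpowerset F.
    by rewrite fpowersetE FE; apply: bigfcup_sup; rewrite ?mem_index_enum.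
  by exists [ffun i => FSetSub (PF i)]; apply/funext => i; rewrite ffunE.
(* Putting all of [F] into one cell provides the initial candidate for [arg_minP]. *)
have partF := fpartition_of_fun F (fun=> Ordinal l_gt0).
have [Q1 Q1E] := code _ partF; rewrite Q1E in partF.
pose isP (Q : {ffun 'I_l -> fpowerset F}) := `[< fpartition F (fun i => val (Q i)) >].
have isPQ1 : isP Q1 by apply/asboolP.
case: (arg_minP (fun Q : {ffun 'I_l -> fpowerset F} => phi (fun i => val (Q i)))
  isPQ1) => Q0 /asboolP partQ0 minQ0.
exists (fun i => val (Q0 i)) => // P partP.
by have [Q PE] := code _ partP; rewrite PE; apply: minQ0; apply/asboolP; rewrite -PE.
Qed.

Lemma e_le_Gamma (l : nat) F (P : 'I_l -> {fset H}) (W : 'I_l -> set H) :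
  fpartition F P -> e F W <= Gamma P W.
Proof.
move=> partP; rewrite /e (big_fpartition _ partP).
by apply: ler_sum => i _; apply: ler_sum => x _; apply: min_ord_le.
Qed.

Lemma e_eq_Gamma (l : nat) F (W : 'I_l -> set H) : (0 < l)%N ->
  exists2 P : 'I_l -> {fset H}, fpartition F P & e F W = Gamma P W.
Proof.
move=> l_gt0.
have [s sE] := choice (fun x : H =>
  min_ord_attained (fun j => dist_to x (W j) ^+ 2) l_gt0).
have partP := fpartition_of_fun F s; exists (fun i => [fset x in F | s x == i]%fset) => //.
rewrite /e (big_fpartition _ partP); apply: eq_bigr => i _.
by apply: eq_big_seq => x; rewrite !inE => /andP[_ /eqP<-].
Qed.

Lemma Gamma_optimal_le (l : nat) C (P : 'I_l -> {fset H}) (V W : 'I_l -> set H) :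
  optimal_bundle C P V -> bundle C W -> Gamma P V <= Gamma P W.
Proof. by move=> [_ optV] CW; apply: ler_sum => i _; apply: (optV i).2. Qed.

Lemma MAP_optimal_bundle (l : nat) C (P : 'I_l -> {fset H}) :
  MAP C -> exists V, optimal_bundle C P V.
Proof.
move=> C_MAP; have [V optV] := choice (fun i => C_MAP (P i)).
by exists V; split=> // i; apply: (optV i).1.
Qed.

(** With [P] a nearest-subspace partition for [W] and [VP] optimal for [P], the chain is [e F V <=
    Gamma P0 V <= Gamma P0 VP0 <= Gamma P VP <= Gamma P W = e F W]. *)
Lemma Gamma_minimal_e_le (l : nat) C F (P0 : 'I_l -> {fset H})
    (VP0 V W : 'I_l -> set H) : (0 < l)%N -> MAP C ->
  Gamma_minimal C F P0 VP0 -> optimal_bundle C P0 V -> bundle C W ->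
  e F V <= e F W.
Proof.
move=> l_gt0 C_MAP [partP0 [CVP0 _] minP0] optV CW.
have [P partP ->] := e_eq_Gamma F W l_gt0.
have [VP optVP] := MAP_optimal_bundle P C_MAP.
apply: le_trans (Gamma_optimal_le optVP CW).
apply: le_trans (minP0 _ _ partP optVP).
exact: le_trans (e_le_Gamma V partP0) (Gamma_optimal_le optV CVP0).
Qed.

(** All bundles optimal for a given partition have the same [Gamma], so it suffices to choose one
    for each partition and compare the chosen ones. *)
Lemma Gamma_minimal_exists (l : nat) C F : (0 < l)%N -> MAP C ->
  exists (P0 : 'I_l -> {fset H}) V0, Gamma_minimal C F P0 V0.
Proof.
move=> l_gt0 C_MAP.
have [opt optP] := choice (fun P : 'I_l -> {fset H} => MAP_optimal_bundle P C_MAP).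
have [P0 partP0 minP0] := fpartition_argmin F (fun P => Gamma P (opt P)) l_gt0.
exists P0, (opt P0); split=> // P W partP optW.
exact: le_trans (minP0 P partP) (Gamma_optimal_le (optP P) optW.1).
Qed.

(** The components of a bundle vary independently, so a minimal sum has every summand minimal. *)
Lemma optimal_bundle_of_Gamma_le (l : nat) C (P : 'I_l -> {fset H})
    (V : 'I_l -> set H) : bundle C V ->
  (forall W, bundle C W -> Gamma P V <= Gamma P W) -> optimal_bundle C P V.
Proof.
move=> CV minV; split=> // i; split=> // U CU.
(* Only the component at [i] is replaced by the competitor [U]; the other summands of [Gamma]
   cancel. *)
have /minV : bundle C (fun j => if j == i then U else V j).
  by move=> j /=; case: ifP.
rewrite /Gamma (bigD1 i) //= [X in _ <= X](bigD1 i) //= eqxx.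
rewrite [X in _ <= _ + X](eq_bigr (fun j => E (P j) (V j))) ?lerD2r //.
by move=> j /negbTE->.
Qed.

(** Let [P0] be a nearest-subspace partition for [V0]. Then [Gamma P0 V0 = e F V0 <= e F W <= Gamma
    P W] for all [P] and [W]. The case [P = P0] makes [V0] optimal for [P0], and the general case
    gives minimality of the pair. *)
Lemma e_min_Gamma_minimal (l : nat) C F (V0 : 'I_l -> set H) : (0 < l)%N ->
  bundle C V0 ->
  (forall W : 'I_l -> set H, bundle C W -> e F V0 <= e F W) ->
  exists P0, Gamma_minimal C F P0 V0.
Proof.
move=> l_gt0 CV0 minV0; have [P0 partP0 eE] := e_eq_Gamma F V0 l_gt0.
have minG (P : 'I_l -> {fset H}) (W : 'I_l -> set H) :
      fpartition F P -> bundle C W -> Gamma P0 V0 <= Gamma P W.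
  move=> partP CW; rewrite -eE.
  exact: le_trans (minV0 W CW) (e_le_Gamma W partP).
exists P0; split=> // [|P W partP [CW _]]; last exact: minG.
by apply: optimal_bundle_of_Gamma_le => // W; apply: minG.
Qed.

End BundlesAndPartitions.

Theorem theorem2p2 (R : realType) (cplx : bool) (H : hilbertType R cplx)
    (C : set (set H)) (m l : nat) (f : 'I_m -> H) (F : {fset H})
    (C_closed_subspace : forall V, C V -> closed_subspace V)
    (C_zero : C [set 0])
    (C_MAP : MAP C)
    (l_gt0 : (0 < l)%N) (m_gt0 : (0 < m)%N) (l_le_m : (l <= m)%N)
    (F_def : F = [fset f i | i in 'I_m]%fset) :
  let einf := inf [set e F V | V in bundle (l := l) C] in
  [/\ exists V0 : 'I_l -> set H, bundle C V0 /\ e F V0 = einf,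
      forall (P0 : 'I_l -> {fset H}) (VP0 : 'I_l -> set H),
        Gamma_minimal C F P0 VP0 ->
        forall V, optimal_bundle C P0 V -> e F V = einf
    & forall V0 : 'I_l -> set H, bundle C V0 -> e F V0 = einf ->
        exists P0 : 'I_l -> {fset H},
          [/\ fpartition F P0, optimal_bundle C P0 V0
            & Gamma_minimal C F P0 V0]].
Proof.
move=> einf.
have [P1 [V1 minP1V1]] := Gamma_minimal_exists F l_gt0 C_MAP.
have [_ optV1 _] := minP1V1; have CV1 := optV1.1.
have minV1 (W : 'I_l -> set H) : bundle C W -> e F V1 <= e F W.
  exact: Gamma_minimal_e_le minP1V1 optV1.
have einf_lb (W : 'I_l -> set H) : bundle C W -> einf <= e F W.
  move=> CW; apply: ge_inf; last by exists W.
  (* [inf] is a genuine lower bound only for a set bounded below; the minimum found at [V1] supplies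
     the bound. *)
  by exists (e F V1) => _ [W' CW' <-]; apply: minV1.
have e_einf (V : 'I_l -> set H) : bundle C V ->
    (forall W : 'I_l -> set H, bundle C W -> e F V <= e F W) -> e F V = einf.
  move=> CV minV; apply/le_anti; rewrite einf_lb // andbT.
  by apply: lb_le_inf => [|_ [W CW <-]]; [exists (e F V), V|apply: minV].
split.
- by exists V1; split=> //; apply: e_einf.
- move=> P0 VP0 minP0 V optV; apply: e_einf => [|W]; first exact: optV.1.
  exact: Gamma_minimal_e_le minP0 optV.
- move=> V0 CV0 eV0.
  have [|P0 minP0] := e_min_Gamma_minimal l_gt0 CV0 (F := F).
    by move=> W CW; rewrite eV0 einf_lb.
  by exists P0; split=> //; case: minP0.
Qed.
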